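(* Let $(X,d)$ be a metric space, let $p\in X$, and let $D=X\setminus\{p\}$. Then for all $x,y\in D$, $$\tau_p(x,y)\le u_p(x,y)\le 2\,\tau_p(x,y).$$ Moreover, the right inequality is sharp for $D=\mathbb{R}^n\setminus\{0\}$ (that is, $X=\mathbb{R}^n$ with the Euclidean metric, $n\ge 2$, and $p=0$): the constant $2$ cannot be replaced by any smaller constant.
   Context: For a metric space $(X,d)$ and $p\in X$, the scale-invariant Cassinian metric on $X\setminus\{p\}$ is $$\tau_p(x,y)=\log\left(1+2\frac{d(x,y)}{\sqrt{d(x,p)\,d(y,p)}}\right),\quad x,y\in X\setminus\{p\}.$$ Ibragimov's metric on $X\setminus\{p\}$ is $$u_p(x,y)=u_{X\setminus\{p\}}(x,y)=2\log\frac{d(x,y)+\max\{d(x,p),d(y,p)\}}{\sqrt{d(x,p)\,d(y,p)}},\quad x,y\in X\setminus\{p\}.$$ *)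

(* Defs.v *)
From HB Require Import structures.
From mathcomp Require Import all_boot all_order all_algebra.
From mathcomp Require Import ring.
From mathcomp Require Import all_classical all_reals all_analysis.

Set Implicit Arguments.
Unset Strict Implicit.
Unset Printing Implicit Defensive.

Import Order.TTheory GRing.Theory Num.Theory.

Local Open Scope ring_scope.

(* Both functions are total on X; they are meaningful for x, y != p, since at p
   the denominator vanishes and division by zero is 0. *)
Definition tau {R : realType} {X : metricType R} (p x y : X) : R :=
  ln (1 + 2 * (mdist x y / Num.sqrt (mdist x p * mdist y p))).

Definition ibragimov {R : realType} {X : metricType R} (p x y : X) : R :=
  2 * ln ((mdist x y + Num.max (mdist x p) (mdist y p)) /
          Num.sqrt (mdist x p * mdist y p)).

(* The canonical metric on 'rV[R]_n is the sup metric, so the Euclidean metric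
   is put on an alias. *)
Definition euclidean (R : realType) (n : nat) : Type := 'rV[R]_n.

HB.instance Definition _ (R : realType) (n : nat) :=
  GRing.Zmodule.on (euclidean R n).

Definition euclidean_dist {R : realType} {n : nat} (x y : 'rV[R]_n) : R :=
  Num.sqrt (\sum_(i < n) (x 0 i - y 0 i) ^+ 2).

Section EuclideanMetric.
Variables (R : realType) (n : nat).
Implicit Types (a b : 'I_n -> R) (x y z : 'rV[R]_n).

Lemma sum_sqr_ge0 a : 0 <= \sum_i a i ^+ 2.
Proof. by apply: sumr_ge0 => i _; exact: sqr_ge0. Qed.

Lemma cauchy_schwarz_sum a b :
  (\sum_i a i * b i) ^+ 2 <= (\sum_i a i ^+ 2) * (\sum_i b i ^+ 2).
Proof.
set A := \sum_i a i ^+ 2; set B := \sum_i b i ^+ 2; set C := \sum_i a i * b i.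
have [B0|B0] := eqVneq B 0.
  have b0 i : b i = 0.
    apply/eqP; rewrite -sqrf_eq0.
    by have := psumr_eq0P (fun i _ => sqr_ge0 (b i)) B0 => ->.
  by rewrite /C big1 ?expr0n ?B0 ?mulr0// => i _; rewrite b0 mulr0.
have Bp : 0 < B by rewrite lt_def B0 sum_sqr_ge0.
have : 0 <= \sum_i (B * a i - C * b i) ^+ 2 by exact: sum_sqr_ge0.
have -> : \sum_i (B * a i - C * b i) ^+ 2 = B * (A * B - C ^+ 2).
  transitivity (\sum_i (B ^+ 2 * a i ^+ 2 - 2 * B * C * (a i * b i)
                        + C ^+ 2 * b i ^+ 2)).
    by apply: eq_bigr => i _; ring.
  by rewrite big_split/= sumrB -!mulr_sumr -/A -/B -/C; ring.
by rewrite pmulr_rge0// subr_ge0.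
Qed.

Lemma euclidean_dist_xx x : euclidean_dist x x = 0.
Proof.
by rewrite /euclidean_dist big1 ?sqrtr0// => i _; rewrite subrr expr0n.
Qed.

Lemma euclidean_dist_eq0 x y : euclidean_dist x y = 0 -> x = y.
Proof.
move=> /eqP; rewrite sqrtr_eq0 => h; apply/rowP => i.
have /eqP h0 : \sum_i (x 0 i - y 0 i) ^+ 2 == 0.
  by rewrite eq_le h sum_sqr_ge0.
apply/eqP; rewrite -subr_eq0 -sqrf_eq0.
by have := psumr_eq0P (fun i _ => sqr_ge0 (x 0 i - y 0 i)) h0 => ->.
Qed.

Lemma euclidean_dist_sym x y : euclidean_dist x y = euclidean_dist y x.
Proof.
by congr Num.sqrt; apply: eq_bigr => i _; rewrite -opprB sqrrN.
Qed.

Lemma euclidean_dist_triangle y x z :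
  euclidean_dist x z <= euclidean_dist x y + euclidean_dist y z.
Proof.
rewrite -(@ler_pXn2r _ 2)// ?nnegrE ?addr_ge0 ?sqrtr_ge0//.
rewrite sqrrD !sqr_sqrtr ?sum_sqr_ge0//.
set a := fun i => x 0 i - y 0 i; set b := fun i => y 0 i - z 0 i.
have -> : \sum_i (x 0 i - z 0 i) ^+ 2 =
    \sum_i a i ^+ 2 + (\sum_i a i * b i) *+ 2 + \sum_i b i ^+ 2.
  rewrite -sumrMnl -!big_split/=; apply: eq_bigr => i _.
  by rewrite -sqrrD /a /b addrA subrK.
rewrite lerD2r lerD2l lerMn2r/= -sqrtrM ?sum_sqr_ge0//.
by rewrite (le_trans (ler_norm _))// -sqrtr_sqr ler_wsqrtr// cauchy_schwarz_sum.
Qed.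

End EuclideanMetric.

HB.instance Definition _ (R : realType) (n : nat) :=
  @isMetric.Build R (euclidean R n) euclidean_dist
    (@euclidean_dist_xx R n) (@euclidean_dist_eq0 R n) (@euclidean_dist_sym R n)
    (@euclidean_dist_triangle R n).

Lemma euclidean_mdistE (R : realType) (n : nat) (x y : euclidean R n) :
  mdist x y = Num.sqrt (\sum_(i < n) ((x : 'rV[R]_n) 0 i - (y : 'rV[R]_n) 0 i) ^+ 2).
Proof. by []. Qed.

(* Main.v *)
Require Import Defs.
From mathcomp Require Import all_boot all_order all_algebra.
From mathcomp Require Import ring lra.
From mathcomp Require Import all_classical all_reals all_analysis.

Import Order.TTheory GRing.Theory Num.Theory.

Local Open Scope ring_scope.

(** Write [t = d(x,y)], [M] and [m] for the maximum and the minimum of [d(x,p)]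
    and [d(y,p)], and [s = sqrt (M m)], so [m <= s <= M].  Exponentiated, the
    left inequality reads [s^2 + 2 t s <= (t + M)^2], which follows from
    [s <= M], and the right one reads [M <= s + t], which follows from
    [M - m <= t] and [m <= s].  The ratio [u / tau] tends to [2] along the
    pairs [(e, - r^2 e)], [e] a unit vector, as [r -> 0]. *)

Lemma sqrt_mul_between (R : realType) (a b : R) : 0 <= a -> a <= b ->
  a <= Num.sqrt (a * b) <= b.
Proof.
move=> a0 ab; have b0 := le_trans a0 ab.
apply/andP; split.
  by rewrite -[leLHS]ger0_norm// -sqrtr_sqr ler_wsqrtr// expr2 ler_wpM2l.
by rewrite -[leRHS]ger0_norm// -sqrtr_sqr ler_wsqrtr// expr2 ler_wpM2r.
Qed.

(** The metric content in real form: [t = d(x,y)], [a = m], [b = M], with the triangle inequality as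
    [b <= t + a]. *)
Lemma ln_sandwich (R : realType) (t a b : R) :
  0 < a -> a <= b -> b <= t + a ->
  ln (1 + 2 * (t / Num.sqrt (a * b))) <= 2 * ln ((t + b) / Num.sqrt (a * b)) /\
  2 * ln ((t + b) / Num.sqrt (a * b)) <=
    2 * ln (1 + 2 * (t / Num.sqrt (a * b))).
Proof.
move=> a0 ab bta; have b0 := lt_le_trans a0 ab.
have /andP[] := @sqrt_mul_between R a b (ltW a0) ab.
have : 0 < Num.sqrt (a * b) by rewrite sqrtr_gt0 mulr_gt0.
(* From here on, all that is kept of the root is [0 < s] and [a <= s <= b]. *)
move: (Num.sqrt (a * b)) => s s0 as_ sb.
have t0 : 0 <= t by lra.
have -> : 1 + 2 * (t / s) = (s + 2 * t) / s by field; rewrite gt_eqF.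
have tau0 : 0 < (s + 2 * t) / s by rewrite divr_gt0//; lra.
have u0 : 0 < (t + b) / s by rewrite divr_gt0//; lra.
split; last first.
  rewrite ler_pM2l// ler_ln ?posrE// ler_pM2r ?invr_gt0//; lra.
rewrite [leRHS]mulr_natl -lnXn// ler_ln ?posrE ?exprn_gt0//.
rewrite expr_div_n ler_pdivlMr ?exprn_gt0//.
have -> : (s + 2 * t) / s * s ^+ 2 = (s + 2 * t) * s.
  by field; rewrite gt_eqF.
(* Expand [(t + b)^2] and use [s^2 <= b^2], [2ts <= 2tb], [0 <= t^2]. *)
nra.
Qed.

Lemma tau_sym (R : realType) (X : metricType R) (p x y : X) :
  tau p x y = tau p y x.
Proof. by rewrite /tau metric_sym [X in Num.sqrt X]mulrC. Qed.

Lemma ibragimov_sym (R : realType) (X : metricType R) (p x y : X) :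
  ibragimov p x y = ibragimov p y x.
Proof. by rewrite /ibragimov metric_sym maxC [X in Num.sqrt X]mulrC. Qed.

Lemma tau_ibragimov_sandwich (R : realType) (X : metricType R) (p x y : X) :
  x != p -> y != p ->
  tau p x y <= ibragimov p x y /\ ibragimov p x y <= 2 * tau p x y.
Proof.
wlog xy : x y / mdist x p <= mdist y p.
  move=> H xp yp; have [xy|/ltW yx] := leP (mdist x p) (mdist y p).
    exact: H.
  by rewrite tau_sym ibragimov_sym; exact: H.
move=> xp yp; rewrite /tau /ibragimov max_r//.
apply: ln_sandwich => //; first by rewrite mdist_gt0.
by rewrite (metric_sym x y) metric_triangle.
Qed.

Lemma euclidean_mdist_line (R : realType) (n : nat) (i : 'I_n) (a b : R) :
  mdist (a *: delta_mx 0 i : euclidean R n) (b *: delta_mx 0 i : euclidean R n)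
  = `|a - b|.
Proof.
rewrite euclidean_mdistE (bigD1 i)//= big1 => [|j ji].
  by rewrite !mxE !eqxx !mulr1 addr0 sqrtr_sqr.
by rewrite !mxE (negbTE ji) andbF !mulr0 subrr expr0n.
Qed.

Lemma euclidean_mdist_line0 (R : realType) (n : nat) (i : 'I_n) (a : R) :
  mdist (a *: delta_mx 0 i : euclidean R n) 0 = `|a|.
Proof.
have := @euclidean_mdist_line R n i a 0.
by rewrite scale0r subr0.
Qed.

(** Here [|x| = 1] and [|y| = m^2], so the root is [m] and [d(x,y) = 1 + m^2]. The numerators are
    then [m + 2(1 + m^2) <= 5] for [tau] and [2 + m^2 >= 2] for [ibragimov]. *)
Lemma antipodal_tau_ibragimov (R : realType) (n : nat) (i : 'I_n) (m : R) :
  0 < m -> m <= 1 ->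
  let x : euclidean R n := 1 *: delta_mx 0 i in
  let y : euclidean R n := (- m ^+ 2) *: delta_mx 0 i in
  tau (0 : euclidean R n) x y <= ln 5 - ln m /\
  2 * (ln 2 - ln m) <= ibragimov (0 : euclidean R n) x y.
Proof.
move=> m0 m1 x y.
have m2 : m ^+ 2 <= 1 by rewrite expr_le1// ltW.
have m20 : 0 < m ^+ 2 by rewrite exprn_gt0.
rewrite /tau /ibragimov /x /y euclidean_mdist_line !euclidean_mdist_line0.
rewrite opprK normrN normr1 mul1r (gtr0_norm m20) sqrtr_sqr (gtr0_norm m0).
rewrite (@ger0_norm _ (1 + m ^+ 2)) ?max_l//; last by lra.
rewrite -!ln_div ?posrE//.
have -> : 1 + 2 * ((1 + m ^+ 2) / m) = (m + 2 * (1 + m ^+ 2)) / m.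
  by field; rewrite gt_eqF.
have tau0 : 0 < m + 2 * (1 + m ^+ 2) by lra.
have u0 : 0 < 1 + m ^+ 2 + 1 by lra.
split.
  rewrite ler_ln ?posrE ?divr_gt0// ler_pM2r ?invr_gt0//; lra.
rewrite ler_pM2l// ler_ln ?posrE ?divr_gt0// ler_pM2r ?invr_gt0//; lra.
Qed.

Lemma two_optimal (R : realType) (n : nat) (i : 'I_n) (c : R) : c < 2 ->
  exists x y : euclidean R n,
    [/\ x != 0, y != 0 &
        c * tau (0 : euclidean R n) x y < ibragimov (0 : euclidean R n) x y].
Proof.
move=> c2.
(* Replacing [c] by a nonnegative [d] lets the upper bound on [tau] be multiplied by the
   constant. *)
pose d := Num.max c 0.
have d2 : d < 2 by rewrite gt_max c2/=.
have d0 : 0 <= d by rewrite le_max lexx orbT.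
have cd : c <= d by rewrite le_max lexx.
have ln50 : 0 <= ln (5 : R) by rewrite ln_ge0// ler1n.
have ln20 : 0 < ln (2 : R) by rewrite ln_gt0// ltr1n.
(* Solves [2 L = d (ln 5 + L)], so that the bounds on [u] and [d tau] for
   [- ln m = L] differ by exactly [2 ln 2]. *)
pose L := d * ln 5 / (2 - d).
have LE : L * (2 - d) = d * ln 5 by rewrite /L divfK// gt_eqF// subr_gt0.
have L0 : 0 <= L by rewrite /L divr_ge0 ?mulr_ge0// subr_ge0 ltW.
have m0 := expR_gt0 (- L).
have m1 : expR (- L) <= 1 by rewrite expR_le1 oppr_le0.
have [tauE uE] := @antipodal_tau_ibragimov R n i _ m0 m1.
move: tauE uE; set x := (1 *: _ : euclidean R n).
set y := (_ *: _ : euclidean R n); rewrite expRK opprK => tauE uE.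
have x0 : x != 0 by rewrite -mdist_gt0 euclidean_mdist_line0 normr1.
have y0 : y != 0.
  rewrite -mdist_gt0 euclidean_mdist_line0 normrN normr_gt0.
  by rewrite expf_neq0 ?gt_eqF.
exists x, y; split => //.
have [tu ut] := @tau_ibragimov_sandwich R _ (0 : euclidean R n) x y x0 y0.
(* Nonnegativity comes from the sandwich: [tau <= u <= 2 tau]. *)
have tau0 : 0 <= tau (0 : euclidean R n) x y by lra.
have h1 : c * tau (0 : euclidean R n) x y <= d * tau (0 : euclidean R n) x y.
  by rewrite ler_wpM2r.
have h2 : d * tau (0 : euclidean R n) x y <= d * (ln 5 + L).
  by rewrite ler_wpM2l.
lra.
Qed.

Theorem theorem3p1 (R : realType) :
  (forall (X : metricType R) (p x y : X), x != p -> y != p ->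
     tau p x y <= ibragimov p x y /\ ibragimov p x y <= 2 * tau p x y) /\
  (forall (n : nat), (2 <= n)%N -> forall c : R, c < 2 ->
     ~ (forall x y : euclidean R n, x != 0 -> y != 0 ->
          ibragimov (0 : euclidean R n) x y <= c * tau (0 : euclidean R n) x y)).
Proof.
split; first exact: tau_ibragimov_sandwich.
move=> n n2 c c2 H.
(* The extremal pair is taken on the axis of coordinate 0, with [ltnW n2] read as [0 < n]. *)
have [x [y [x0 y0]]] := @two_optimal R n (Ordinal (ltnW n2)) c c2.
by rewrite ltNge H.
Qed.
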